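(* Let $n\ge 3$ be odd and put $M=(n-1)^{n-1}$. Suppose that for every integer $x\ge 1$ $$\sum_{j=0}^{\frac{n-1}{2}}(-1)^j\binom{n}{2j+1}S_{n,0}\big((n-1)^{2j}x\big)=\sum_{j=0}^{n-1}S_{n,j}(x).$$ Define, for integers $x\ge 0$, $\nu_n(x)$ by $$S_{n,0}(x)=\sum_{j=0}^{\frac{n-3}{2}}(-1)^{\frac{n-3}{2}-j}\binom{n}{2j+1}S_{n,0}\Big((n-1)^{2j}\Big\lfloor\frac{x}{M}\Big\rfloor\Big)+\nu_n(x).$$ Then the sequence $\big((-1)^{s_{n-1}(x)}\nu_n(x)\big)_{x\ge 0}$ is periodic with period $2n(n-1)^{n-1}$.
   Context: For an integer $b\ge 2$ and integer $r\ge 0$, $s_b(r)$ denotes the sum of the digits of $r$ in base $b$. For integers $n\ge 3$, $0\le j\le n-1$ and $x\ge 0$, define $$S_{n,j}(x)=\sum_{0\le r<x,\; r\equiv j \pmod n}(-1)^{s_{n-1}(r)}.$$ *)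

(* Defs.v *)
From mathcomp Require Export all_boot all_order all_algebra.

Set Implicit Arguments.
Unset Strict Implicit.
Unset Printing Implicit Defensive.

Import GRing.Theory.
Local Open Scope ring_scope.

(* The digit of r at position i is (r %/ b ^ i) %% b; for 2 <= b it vanishes
   at every position i >= r, because r < b ^ r. *)
Definition digit_sum (b r : nat) : nat :=
  (\sum_(0 <= i < r) (r %/ b ^ i) %% b)%N.

Definition S_sum (n j x : nat) : int :=
  \sum_(0 <= r < x | r == j %[mod n]) (-1) ^+ digit_sum (n - 1) r.

(* Main.v *)
Require Import Defs.
From mathcomp Require Import all_boot all_order all_algebra.
From mathcomp Require Import zify.

Set Implicit Arguments.
Unset Strict Implicit.
Unset Printing Implicit Defensive.

Import GRing.Theory.
Local Open Scope ring_scope.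

(** Write [b = n - 1], [M = b ^ b], [e(r) = (-1)^(s_b(r))] and [x = M q + t]
    with [t < M].  As [e(M q + u) = e(q) e(u)] for [u < M], the terms of
    [S_{n,0}(x)] of index at least [M q] contribute [e(q) S_{n,i}(t)], where
    the residue [i] is that of [- M q] modulo [n].  The assumed relation at
    [q], solved for its top term [S_{n,0}(M q)], turns the definition of
    [nu(x)] into [nu(x) = (-1)^((n-1)/2) E(q) + e(q) S_{n,i}(t)] with
    [E(q) = sum_(r < q) e(r)].  Since [b] is even, [e(2k) + e(2k+1) = 0], so
    [E(q)] is [- e(q)] for odd [q] and [0] for even [q].  Hence [e(x) nu(x)]
    depends only on [t], the parity of [q], and [q] modulo [n]. *)

Lemma digit_sum_widen (b r N : nat) : (1 < b)%N -> (r <= N)%N ->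
  digit_sum b r = (\sum_(0 <= i < N) (r %/ b ^ i) %% b)%N.
Proof.
move=> b_gt1 rN; rewrite /digit_sum [RHS](big_cat_nat (n := r)) //=.
rewrite -[LHS]addn0; congr (_ + _)%N.
rewrite big_nat big1 // => i /andP[ri _].
by rewrite divn_small ?mod0n // (leq_ltn_trans ri) // ltn_expl.
Qed.

Lemma digit_sum_divn_modn (b r : nat) : (1 < b)%N ->
  digit_sum b r = (digit_sum b (r %/ b) + r %% b)%N.
Proof.
move=> b_gt1; rewrite (@digit_sum_widen b r r.+1) //.
rewrite (@digit_sum_widen b (r %/ b) r) ?leq_div //.
rewrite big_nat_recl // expn0 divn1 addnC; congr (_ + _)%N.
by apply: eq_bigr => i _; rewrite expnS divnMA.
Qed.

Lemma digit_sum_expnMD (b k q t : nat) : (1 < b)%N -> (t < b ^ k)%N ->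
  digit_sum b (b ^ k * q + t) = (digit_sum b q + digit_sum b t)%N.
Proof.
move=> b_gt1; have b_gt0 : (0 < b)%N by apply: ltnW.
elim: k t => [|k IHk] t t_lt.
  by case: t t_lt => // _; rewrite mul1n addn0 [digit_sum b 0]big_geq ?addn0.
rewrite digit_sum_divn_modn // [digit_sum b t]digit_sum_divn_modn //.
rewrite expnSr mulnAC divnMDl // modnMDl addnA IHk //.
by rewrite ltn_divLR // -expnSr.
Qed.

Lemma digit_sumS (b r : nat) : (1 < b)%N -> ~~ (b %| r.+1)%N ->
  digit_sum b r.+1 = (digit_sum b r).+1.
Proof.
move=> b_gt1 no_carry; rewrite digit_sum_divn_modn // divnS 1?ltnW // modnS.
by rewrite (negbTE no_carry) addnS -digit_sum_divn_modn.
Qed.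

Definition digit_sign (b r : nat) : int := (-1) ^+ digit_sum b r.

Lemma digit_sign_expnMD (b k q t : nat) : (1 < b)%N -> (t < b ^ k)%N ->
  digit_sign b (b ^ k * q + t) = digit_sign b q * digit_sign b t.
Proof. by move=> b_gt1 t_lt; rewrite /digit_sign digit_sum_expnMD // exprD. Qed.

Lemma sum_digit_sign (b q : nat) : (1 < b)%N -> ~~ odd b ->
  \sum_(0 <= r < q) digit_sign b r = - digit_sign b q *+ odd q.
Proof.
move=> b_gt1 b_even; elim: q => [|q IHq]; first by rewrite big_geq.
rewrite big_nat_recr //= IHq; case q_odd: (odd q) => /=.
  by rewrite mulr1n mulr0n addNr.
have no_carry : ~~ (b %| q.+1)%N.
  by apply: contraNN b_even => /dvdn_odd ->; rewrite //= q_odd.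
by rewrite /digit_sign digit_sumS // exprS mulN1r opprK add0r.
Qed.

Lemma sum_residue_classes (V : nmodType) (F : nat -> V) (n x : nat) :
  (0 < n)%N ->
  \sum_(0 <= j < n) \sum_(0 <= r < x | r == j %[mod n]) F r =
  \sum_(0 <= r < x) F r.
Proof.
move=> n_gt0; under eq_bigr do rewrite big_mkcond.
rewrite exchange_big; apply: eq_bigr => r _; rewrite big_mkord.
rewrite (bigD1 (Ordinal (ltn_pmod r n_gt0))) //= modn_mod eqxx big1 ?addr0 //.
by move=> j; rewrite -val_eqE /= (modn_small (ltn_ord j)) eq_sym => /negbTE ->.
Qed.

Lemma alternating_sum_last (R : pzRingType) (a : nat -> R) (m : nat) :
  a m = \sum_(0 <= j < m) (-1) ^+ (m.-1 - j) * a j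
        + (-1) ^+ m * \sum_(0 <= j < m.+1) (-1) ^+ j * a j.
Proof.
rewrite [in X in _ + X]big_nat_recr //= mulrDr signrMK addrA big_distrr.
rewrite -big_split /= big_nat big1 ?add0r // => j /= j_lt_m.
have -> : m = ((m.-1 - j) + j).+1 by lia.
by rewrite /= addnK exprS exprD mulN1r mulNr -mulrA signrMK subrr.
Qed.

Lemma S_sum_modn (n j x : nat) : S_sum n (j %% n) x = S_sum n j x.
Proof. by rewrite /S_sum modn_mod. Qed.

Lemma S_sum0 (n j : nat) : S_sum n j 0 = 0.
Proof. by rewrite /S_sum big_geq. Qed.

(* The factor [n - 1] plays the role of [-1] modulo [n]. *)
Lemma S_sum_expnMD (n j k q t : nat) : (2 < n)%N -> (t <= (n - 1) ^ k)%N ->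
  S_sum n j ((n - 1) ^ k * q + t) =
  S_sum n j ((n - 1) ^ k * q) +
  digit_sign (n - 1) q * S_sum n (j + (n - 1) * ((n - 1) ^ k * q)) t.
Proof.
move=> n_gt2 t_le; set y := ((n - 1) ^ k * q)%N.
rewrite {1}/S_sum (big_cat_nat (n := y)) ?leq_addr //=.
congr (_ + _); rewrite -{1}[y]add0n big_addn addKn.
rewrite /S_sum big_distrr /= [LHS]big_nat_cond [RHS]big_nat_cond.
apply: eq_big => [u|u /andP[/andP[_ u_lt] _]].
  rewrite -(eqn_modDr y u) -addnA -mulSnr subn1 prednK; last by lia.
  by rewrite [(j + _)%N]addnC (mulnC n) modnMDl.
rewrite addnC -!/(digit_sign _ _) digit_sign_expnMD //; first by lia.
exact: leq_trans t_le.
Qed.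

Definition lower_scale_sum (n x : nat) : int :=
  \sum_(0 <= j < ((n - 3) %/ 2).+1)
    (-1) ^+ ((n - 3) %/ 2 - j) * 'C(n, 2 * j + 1)%:Z
      * S_sum n 0 ((n - 1) ^ (2 * j) * x)%N.

Section ScaleRelation.

Variable n : nat.
Hypotheses (n_ge3 : (3 <= n)%N) (n_odd : odd n).

Local Notation b := (n - 1)%N.
Local Notation M := (b ^ b)%N.
Local Notation m := (b %/ 2)%N.

Hypothesis scale_relation : forall x : nat, (1 <= x)%N ->
  \sum_(0 <= j < m.+1)
     (-1) ^+ j * 'C(n, 2 * j + 1)%:Z * S_sum n 0 (b ^ (2 * j) * x)%N
  = \sum_(0 <= j < n) S_sum n j x.

Lemma scale_relation_digit_sign (x : nat) :
  \sum_(0 <= j < m.+1)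
     (-1) ^+ j * ('C(n, 2 * j + 1)%:Z * S_sum n 0 (b ^ (2 * j) * x)%N)
  = \sum_(0 <= r < x) digit_sign b r.
Proof.
case: x => [|x].
  by rewrite [RHS]big_geq // big1 // => j _; rewrite muln0 S_sum0 !mulr0.
under eq_bigr do rewrite mulrA.
by rewrite scale_relation // sum_residue_classes //; lia.
Qed.

Lemma S_sum_top_scale (q : nat) :
  S_sum n 0 (M * q) =
  lower_scale_sum n q + (-1) ^+ m * \sum_(0 <= r < q) digit_sign b r.
Proof.
pose a j := 'C(n, 2 * j + 1)%:Z * S_sum n 0 (b ^ (2 * j) * q)%N.
have [mE m_predE] : (2 * m = b)%N /\ m.-1 = ((n - 3) %/ 2)%N by lia.
have -> : S_sum n 0 (M * q) = a m.
  by rewrite /a mE (_ : b + 1 = n)%N ?binn ?mul1r //; lia.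
rewrite (alternating_sum_last a) scale_relation_digit_sign; congr (_ + _).
rewrite /lower_scale_sum -m_predE prednK; last by lia.
by apply: eq_bigr => j _; rewrite mulrA.
Qed.

Variable nu : nat -> int.
Hypothesis nu_def : forall x : nat,
  S_sum n 0 x = lower_scale_sum n (x %/ M) + nu x.

Lemma digit_sign_nu (q t : nat) : (t < M)%N ->
  digit_sign b (M * q + t) * nu (M * q + t)%N =
  digit_sign b t * (S_sum n (b * (M * q)) t - (-1) ^+ m *+ odd q).
Proof.
move=> t_lt; have b_gt1 : (1 < b)%N by lia.
have nuE : nu (M * q + t)%N =
    digit_sign b q * (S_sum n (b * (M * q)) t - (-1) ^+ m *+ odd q).
  have := nu_def (M * q + t).
  rewrite (S_sum_expnMD _ _ n_ge3 (ltnW t_lt)) S_sum_top_scale.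
  have -> : ((M * q + t) %/ M = q)%N.
    by rewrite mulnC divnMDl ?divn_small ?addn0 ?(leq_trans _ t_lt).
  rewrite -addrA => /addrI <-.
  rewrite sum_digit_sign //; last by lia.
  by rewrite add0n addrC mulrBr !mulrnAr mulrN mulNrn [_ ^+ m * _]mulrC.
rewrite nuE digit_sign_expnMD // [_ q * _]mulrC -mulrA.
by rewrite /digit_sign signrMK.
Qed.

End ScaleRelation.

Theorem theorem8 (n : nat) (n_ge3 : (3 <= n)%N) (n_odd : odd n)
    (hS : forall x : nat, (1 <= x)%N ->
      \sum_(0 <= j < ((n - 1) %/ 2).+1)
         (-1) ^+ j * 'C(n, 2 * j + 1)%:Z * S_sum n 0 ((n - 1) ^ (2 * j) * x)%N
      = \sum_(0 <= j < n) S_sum n j x)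
    (nu : nat -> int)
    (hnu : forall x : nat,
      S_sum n 0 x =
        \sum_(0 <= j < ((n - 3) %/ 2).+1)
           (-1) ^+ ((n - 3) %/ 2 - j) * 'C(n, 2 * j + 1)%:Z
             * S_sum n 0 ((n - 1) ^ (2 * j) * (x %/ (n - 1) ^ (n - 1)))%N
        + nu x) :
  forall x : nat,
    (-1) ^+ digit_sum (n - 1) (x + 2 * n * (n - 1) ^ (n - 1))
      * nu (x + 2 * n * (n - 1) ^ (n - 1))%N
    = (-1) ^+ digit_sum (n - 1) x * nu x.
Proof.
move=> x; rewrite -!/(digit_sign _ _).
set b := (n - 1)%N; set M := (b ^ b)%N.
set q := (x %/ M)%N; set t := (x %% M)%N.
have t_lt : (t < M)%N by rewrite ltn_mod expn_gt0 /b; lia.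
have xE : x = (M * q + t)%N by rewrite mulnC -divn_eq.
have shiftE : (x + 2 * n * M = M * (q + 2 * n) + t)%N by rewrite xE; lia.
have same_parity : odd (q + 2 * n) = odd q.
  by rewrite oddD mul2n odd_double addbF.
have same_residue : (b * (M * (q + 2 * n)) = b * (M * q) %[mod n])%N.
  by rewrite (mulnDr M) mulnDr addnC !mulnA modnMDl.
rewrite shiftE xE !(digit_sign_nu n_ge3 n_odd hS hnu) // same_parity.
by rewrite -[S_sum n _ t]S_sum_modn same_residue S_sum_modn.
Qed.
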